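(* Let the second-order system $\Sigma$ be asymptotically stable and satisfy the passivity condition $M>0$, $D>0$, $K>0$, $C_1=B^\top$, $C_0=0$. Then the reduced system $\widehat\Sigma_G$ with parameters $$F_2=\Pi^\top M\Pi,\quad F_1=\Pi^\top D\Pi,\quad F_0=\Pi^\top K\Pi,\quad G=\Pi^\top B,\quad H_1=B^\top\Pi,$$ and the reduced system $\widehat\Sigma_H$ with parameters $$F_2=\Upsilon M\Upsilon^\top,\quad F_1=\Upsilon D\Upsilon^\top,\quad F_0=\Upsilon K\Upsilon^\top,\quad G=\Upsilon B,\quad H_1=B^\top\Upsilon^\top,\quad H_0=0,$$ are asymptotically stable and passive.
   Context: $\Sigma$ is the single-input single-output second-order system $M\ddot x+D\dot x+Kx=Bu$, $y=C_1\dot x+C_0x$, with $M,D,K\in\mathbb{R}^{n\times n}$, $B\in\mathbb{R}^{n}$, $C_0,C_1\in\mathbb{R}^{1\times n}$, and $\Omega=\{s\in\mathbb{C}:\det(Ms^2+Ds+K)=0\}$. $\nu<n$; $S,Q\in\mathbb{R}^{\nu\times\nu}$, $L\in\mathbb{R}^{1\times\nu}$, $R\in\mathbb{R}^\nu$ are such that $(L,S)$ is observable, $(Q,R)$ is controllable, $\sigma(S)\cap\Omega=\sigma(Q)\cap\Omega=\emptyset$; $\Pi\in\mathbb{R}^{n\times\nu}$ and $\Upsilon\in\mathbb{R}^{\nu\times n}$ are the unique solutions of $M\Pi S^2+D\Pi S+K\Pi=BL$ and $Q^2\Upsilon M+Q\Upsilon D+\Upsilon K=RC_0+QRC_1$,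 assumed to have full rank $\nu$. A reduced model is $F_2\ddot\xi+F_1\dot\xi+F_0\xi=Gu$, $\psi=H_1\dot\xi+H_0\xi$, of order $\nu$. In the family $\widehat\Sigma_G$, $F_0=GL-F_2S^2-F_1S$ and $H_0=C_0\Pi+C_1\Pi S-H_1S$. In the family $\widehat\Sigma_H$, $F_0=RH_0+QRH_1-Q^2F_2-QF_1$ and $G=\Upsilon B$. $X>0$ means that $X$ is real symmetric and positive definite. Asymptotic stability: with $u=0$, $(\xi(t),\dot\xi(t))\to0$ as $t\to\infty$ for all initial conditions. A system with input $u$ and output $\psi$ is passive if there is a nonnegative storage function $V$ of the state $(\xi,\dot\xi)$ with $V(t_1)-V(t_0)\le\int_{t_0}^{t_1}u(t)\psi(t)\,dt$ along all trajectories. *)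

(* Defs.v *)
From HB Require Import structures.
From mathcomp Require Export all_boot all_order all_algebra.
From mathcomp Require Export all_classical all_reals all_analysis.
From mathcomp Require Export complex.

Set Implicit Arguments.
Unset Strict Implicit.
Unset Printing Implicit Defensive.
Import Order.TTheory GRing.Theory Num.Theory numFieldNormedType.Exports.
Local Open Scope classical_set_scope.
Local Open Scope complex_scope.
Local Open Scope ring_scope.

(* F2 x'' + F1 x' + F0 x = G u,  y = H1 x' + H0 x,  with u and y scalar *)
Record sosys (R : realType) (n : nat) := SoSys {
  F2 : 'M[R]_n; F1 : 'M[R]_n; F0 : 'M[R]_n;
  G : 'cV[R]_n;
  H1 : 'rV[R]_n; H0 : 'rV[R]_n }.

Section Systems.
Variables (R : realType) (n : nat).
Implicit Types (sys : sosys R n) (u : R -> R) (x v : R -> 'cV[R]_n).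
Local Notation mu := (@lebesgue_measure R).

Definition locally_integrable0 (f : R -> R) : Prop :=
  forall t : R, 0 <= t -> mu.-integrable `[0, t] (EFin \o f).

(* f is locally absolutely continuous on [0, +oo[ with a.e. derivative f' *)
Definition primitive_of (f f' : R -> R) : Prop :=
  locally_integrable0 f' /\
  forall t : R, 0 <= t -> f t = f 0 + \int[mu]_(s in `[0, t]) f' s.

(* Solutions on [0, +oo[ in the sense of Caratheodory, for an arbitrary locally
   integrable input: x is C^1 with x' = v, v is locally absolutely continuous
   with derivative a, and the equation holds almost everywhere. When u is
   continuous and F2 is invertible these are the classical C^2 solutions. The
   values of u, x, v at negative times are irrelevant. *)
Definition trajectory sys u x v : Prop :=
  locally_integrable0 u /\
  exists a : R -> 'cV[R]_n,
    [/\ forall i, primitive_of (fun t => x t i 0) (fun t => v t i 0),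
        forall i, primitive_of (fun t => v t i 0) (fun t => a t i 0) &
        {ae mu, forall t : R, 0 <= t ->
           F2 sys *m a t + F1 sys *m v t + F0 sys *m x t = u t *: G sys}].

Definition output sys x v (t : R) : R := (H1 sys *m v t + H0 sys *m x t) 0 0.

(* Every initial condition must be attained by some unforced trajectory, so the
   property cannot hold vacuously when F2 is singular. *)
Definition asymptotically_stable sys : Prop :=
  forall x0 v0 : 'cV[R]_n,
    (exists x v, [/\ trajectory sys (fun=> 0) x v, x 0 = x0 & v 0 = v0]) /\
    (forall x v, trajectory sys (fun=> 0) x v -> x 0 = x0 -> v 0 = v0 ->
       x t @[t --> +oo] --> (0 : 'cV[R]_n) /\
       v t @[t --> +oo] --> (0 : 'cV[R]_n)).

Definition passive sys : Prop :=
  exists V : 'cV[R]_n -> 'cV[R]_n -> R,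
    (forall x0 v0 : 'cV[R]_n, 0 <= V x0 v0) /\
    (forall u x v, trajectory sys u x v ->
       forall t0 t1 : R, 0 <= t0 -> t0 <= t1 ->
       V (x t1) (v t1) - V (x t0) (v t0)
         <= \int[mu]_(t in `[t0, t1]) (u t * output sys x v t)).

Definition posdef (X : 'M[R]_n) : Prop :=
  X^T = X /\ forall x : 'cV[R]_n, x != 0 -> 0 < (x^T *m X *m x) 0 0.

(* Kalman rank conditions *)
Definition observable (L : 'rV[R]_n) (S : 'M[R]_n) : Prop :=
  \rank (\matrix_(k < n) (L *m S ^+ k)) = n.

Definition controllable (Q : 'M[R]_n) (r : 'cV[R]_n) : Prop :=
  \rank (\matrix_(i < n, k < n) (Q ^+ k *m r) i 0) = n.

Definition toC (A : 'M[R]_n) : 'M[R[i]]_n := map_mx (real_complex R) A.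

Definition spectrum (A : 'M[R]_n) : set R[i] := [set s | eigenvalue (toC A) s].

Definition Omega sys : set R[i] :=
  [set s | \det (s ^+ 2 *: toC (F2 sys) + s *: toC (F1 sys) + toC (F0 sys)) = 0].

End Systems.

Section Families.
Variables (R : realType) (n nu : nat) (Sigma : sosys R n).

Definition right_sylvester (L : 'rV[R]_nu) (S : 'M[R]_nu) (Pi : 'M[R]_(n, nu)) :
    Prop :=
  F2 Sigma *m Pi *m S ^+ 2 + F1 Sigma *m Pi *m S + F0 Sigma *m Pi
  = G Sigma *m L.

Definition left_sylvester (Q : 'M[R]_nu) (r : 'cV[R]_nu)
    (Ups : 'M[R]_(nu, n)) : Prop :=
  Q ^+ 2 *m Ups *m F2 Sigma + Q *m Ups *m F1 Sigma + Ups *m F0 Sigma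
  = r *m H0 Sigma + Q *m r *m H1 Sigma.

Definition family_G (L : 'rV[R]_nu) (S : 'M[R]_nu) (Pi : 'M[R]_(n, nu))
    (red : sosys R nu) : Prop :=
  F0 red = G red *m L - F2 red *m S ^+ 2 - F1 red *m S /\
  H0 red = H0 Sigma *m Pi + H1 Sigma *m Pi *m S - H1 red *m S.

Definition family_H (Q : 'M[R]_nu) (r : 'cV[R]_nu) (Ups : 'M[R]_(nu, n))
    (red : sosys R nu) : Prop :=
  F0 red = r *m H0 red + Q *m r *m H1 red - Q ^+ 2 *m F2 red - Q *m F1 red /\
  G red = Ups *m G Sigma.

End Families.

(* Main.v *)
Require Import Defs.
From mathcomp Require Import all_boot all_order all_algebra.
From mathcomp Require Import all_classical all_reals all_analysis.
From mathcomp Require Import complex.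
From mathcomp Require Import ring lra measurable_realfun.
Set Implicit Arguments.
Unset Strict Implicit.
Unset Printing Implicit Defensive.
Import Order.TTheory GRing.Theory Num.Theory numFieldNormedType.Exports.
Local Open Scope classical_set_scope.
Local Open Scope ring_scope.

(* A congruence by a matrix of full rank preserves positive definiteness, and
   the Sylvester equations, multiplied by Pi^T or Ups^T, place both reduced
   models in their families. So everything reduces to a system with positive
   definite F2, F1, F0, H1 = G^T and H0 = 0. Passivity: the energy
   (v^T F2 v + x^T F0 x) / 2 has derivative u y - v^T F1 v. Stability: adding a
   small multiple of x^T F2 v to the energy gives a positive definite E with
   E' <= - c E; then E is nonincreasing, so c t E(t) <= c int_0^t E <= E(0).
   Unforced trajectories exist by the power series of exp(t A). As inputs are
   only locally integrable, energies are differentiated with the product rule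
   for absolutely continuous functions, which follows from Fubini's theorem. *)

(** * Calculus of locally absolutely continuous functions *)

Section LocallyAbsolutelyContinuous.
Variable R : realType.
Notation mu := (@lebesgue_measure R).
Implicit Types (f g : R -> R) (T s t : R).

Lemma integrable_patch f (D : set R) : measurable D ->
  mu.-integrable D (EFin \o f) -> mu.-integrable setT (EFin \o (f \_ D)).
Proof.
move=> mD fi; rewrite -restrict_EFin.
by apply/integrable_restrict => //; rewrite setTI; exact: fi.
Qed.

(* The sigma-algebra on which [lebesgue_measure] is defined; the structure
   inferred from R itself is a different term, for which products of [mu] are
   ill-typed. *)
Let X := measurableTypeR R.

(** Both sides are iterated integrals of [f s * g t] over the triangle 0 <= t <= s <= T, so Fubini's
    theorem applies. This is the core of the product rule. *)
Lemma Rintegral_triangle_swap f g T :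
  mu.-integrable `[0, T] (EFin \o f) -> mu.-integrable `[0, T] (EFin \o g) ->
  \int[mu]_(s in `[0, T]) (f s * \int[mu]_(t in `[0, s]) g t) =
  \int[mu]_(t in `[0, T]) (g t * \int[mu]_(s in `[t, T]) f s).
Proof.
move=> fi gi.
pose p := f \_ `[0, T]; pose q := g \_ `[0, T].
(* The integrand is extended by zero from the triangle to the whole plane. *)
pose F (z : X * X) : R := p z.1 * q z.2 * ((z.2 : R) <= z.1)%R%:R.
have ip : mu.-integrable setT (EFin \o p).
  exact: integrable_patch.
have qi : mu.-integrable setT (EFin \o q).
  exact: integrable_patch.
have mp : measurable_fun setT p.
  by apply/measurable_EFinP; exact: measurable_int ip.
have mq : measurable_fun setT q.
  by apply/measurable_EFinP; exact: measurable_int qi.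
have mF : measurable_fun setT (EFin \o F).
  apply/measurable_EFinP; apply: measurable_funM.
    by apply: measurable_funM; exact: measurableT_comp.
  rewrite (_ : (fun z : X * X => _) =
     (fun z => if ((z.2 : R) <= z.1)%R then 1 else 0 : R)); last first.
    by apply/funext => z; case: ifP.
  by apply: measurable_fun_ifT => //; apply: measurable_fun_ler;
    [exact: measurable_snd|exact: measurable_fst].
have Fi : (mu \x mu)%E.-integrable setT (EFin \o F).
  (* By Tonelli it suffices to bound the iterated integral of [|F|]; dropping the indicator leaves
     |p(s)| |q(t)|, whose integral is a product of two finite ones. *)
  apply: (integrable12ltyP mu mu mF).2.
  apply: (@le_lt_trans _ _
    (\int[mu]_s (`|(p s)%:E| * \int[mu]_t `|(q t)%:E|))%E).
    apply: ge0_le_integral => //=.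
    - by move=> s _; exact: integral_ge0.
    - apply: (@measurable_fun_fubini_tonelli_F _ _ _ _ _ mu
        (fun z => `|(EFin \o F) z|)%E) => //.
      by apply: measurableT_comp.
    - apply: emeasurable_funM => //.
      by apply/measurable_EFinP; exact: measurableT_comp.
    - move=> s _; rewrite -ge0_integralZl//=.
      + apply: ge0_le_integral => //=.
        * apply/measurable_EFinP; apply: measurableT_comp => //.
          apply: (measurableT_comp (f := F) (g := fun y => (s, y))).
            exact/measurable_EFinP.
          exact: measurable_pair1.
        * apply/measurable_EFinP; apply: measurable_funM => //.
          exact: measurableT_comp.
        * move=> t _; rewrite lee_fin /F/= !normrM ler_piMr//.
          by case: (t <= s); rewrite ?normr1// normr0.
      + by apply/measurable_EFinP; exact: measurableT_comp.
  have [/integrableP[_ qoo] /integrableP[_ poo]] := (qi, ip).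
  rewrite ge0_integralZr//=; last 2 first.
    by apply/measurable_EFinP; exact: measurableT_comp.
    exact: integral_ge0.
  by apply: lte_mul_pinfty; rewrite ?integral_ge0// ge0_fin_numE ?integral_ge0.
have := Fubini Fi.
(* For fixed s in [0, T] the section of the triangle is [0, s]; off [0, T] it is empty. *)
have -> : (fun s => \int[mu]_t (EFin \o F) (s, t))%E =
    EFin \o ((fun s => f s * \int[mu]_(t in `[0, s]) g t) \_ `[0, T]).
  apply/funext => s /=; rewrite patchE.
  case: ifPn => [/set_mem/= sT|sT]; last first.
    apply: integral0_eq => t _ /=.
    by rewrite /F /p patchE (negbTE sT) !mul0r.
  move: (sT); rewrite in_itv/= => /andP[s0 sT'].
  transitivity (\int[mu]_t ((f s)%:E * (((g \_ `[0, s]) t)%:E)))%E.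
    apply: eq_integral => t _; rewrite /F /= /p /q !patchE mem_set//=.
    rewrite -EFinM -mulrA; congr (_ * _)%:E.
    have [st|st] := leP t s; rewrite ?mulr1 ?mulr0.
      have [/set_mem/=|] := boolP (t \in _).
        rewrite in_itv/= => /andP[t0 _].
        by rewrite mem_set//= in_itv/= t0 st.
      move=> /negP tn; case: ifPn => // /set_mem/=.
      rewrite in_itv/= => /andP[t0 _].
      by case: tn; apply/mem_set; rewrite /= in_itv/= t0 (le_trans st).
    by case: ifPn => // /set_mem/=; rewrite in_itv/= (leNgt t) st andbF.
  have gs : mu.-integrable `[0, s] (EFin \o g).
    by apply: integrableS gi => //; apply: subset_itvl; rewrite bnd_simp.
  have gs' : mu.-integrable setT (EFin \o (g \_ `[0, s])).
    exact: integrable_patch.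
  rewrite (integralZl _ gs')// EFinM; congr (_ * _)%E.
  rewrite Rintegral_mkcond /Rintegral fineK//.
  exact: integrable_fin_num gs'.
(* In the other order, the section at height t is [t, T]. *)
have -> : (fun t => \int[mu]_s (EFin \o F) (s, t))%E =
    EFin \o ((fun t => g t * \int[mu]_(s in `[t, T]) f s) \_ `[0, T]).
  apply/funext => s /=; rewrite patchE.
  case: ifPn => [/set_mem/= sT|sT]; last first.
    apply: integral0_eq => t _ /=.
    by rewrite /F /q patchE (negbTE sT) mulr0 !mul0r.
  move: (sT); rewrite in_itv/= => /andP[s0 sT'].
  transitivity (\int[mu]_t ((g s)%:E * (((f \_ `[s, T]) t)%:E)))%E.
    apply: eq_integral => t _; rewrite /F /= /p /q !patchE.
    rewrite (@mem_set _ `[0, T]%classic s sT)/=.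
    rewrite -EFinM mulrAC mulrC; congr (_ * _)%:E.
    have [st|st] := leP s t; rewrite ?mulr1 ?mulr0.
      have [/set_mem/=|] := boolP (t \in _).
        rewrite in_itv/= => /andP[_ t0].
        by rewrite mem_set//= in_itv/= t0 st.
      move=> /negP tn; case: ifPn => // /set_mem/=.
      rewrite in_itv/= => /andP[_ t0].
      by case: tn; apply/mem_set; rewrite /= in_itv/= t0 (le_trans s0).
    by case: ifPn => // /set_mem/=; rewrite in_itv/= (leNgt s) st.
  have gs : mu.-integrable `[s, T] (EFin \o f).
    by apply: integrableS fi => //; apply: subset_itvr; rewrite bnd_simp.
  have gs' : mu.-integrable setT (EFin \o (f \_ `[s, T])).
    exact: integrable_patch.
  rewrite (integralZl _ gs')// EFinM; congr (_ * _)%E.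
  rewrite Rintegral_mkcond /Rintegral fineK//.
  exact: integrable_fin_num gs'.
by move/(congr1 fine); rewrite -![fine _]/(Rintegral _ _ _) -!Rintegral_mkcond.
Qed.

Lemma primitive_continuous f (f' : R -> R) T : primitive_of f f' -> 0 <= T ->
  {within `[0, T], continuous f}.
Proof.
move=> [fi fE] T0.
have h := parameterized_integral_continuous T0 (fi T T0).
apply: (@subspace_eq_continuous _ _ _
  (fun x => f 0 + parameterized_integral mu 0 x f')).
  move=> x /set_mem/=; rewrite in_itv/= => /andP[x0 _].
  by rewrite [RHS]fE.
move=> x; apply: cvgD; first exact: cvg_cst.
exact: h.
Qed.

Lemma primitive_measurable f (f' : R -> R) T : primitive_of f f' -> 0 <= T ->
  measurable_fun (`[0, T]%classic : set X) (f : X -> R).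
Proof.
move=> ff' T0; apply: subspace_continuous_measurable_fun => //.
exact: primitive_continuous ff' T0.
Qed.

Lemma primitive_bounded f (f' : R -> R) T : primitive_of f f' -> 0 <= T ->
  [bounded f t | t in `[0, T]%classic].
Proof.
move=> ff' T0.
have /compact_bounded[M [_ Mf]] := continuous_compact
  (primitive_continuous ff' T0) (@segment_compact _ 0 T).
by exists M; split; rewrite ?num_real// => x Mx y Ty; apply: Mf => //; exists y.
Qed.

Lemma primitive_locally_integrable f (f' : R -> R) : primitive_of f f' ->
  locally_integrable0 f.
Proof.
move=> ff' t t0; apply: continuous_compact_integrable.
  exact: segment_compact.
exact: primitive_continuous ff' t0.
Qed.

Lemma locally_integrableD f g :
  locally_integrable0 f -> locally_integrable0 g ->
  locally_integrable0 (fun t => f t + g t).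
Proof. by move=> fi gi t t0; exact: (integrableD _ (fi t t0) (gi t t0)). Qed.

Lemma locally_integrableZ (c : R) f : locally_integrable0 f ->
  locally_integrable0 (fun t => c * f t).
Proof. by move=> fi t t0; apply: (integrableZl _ c (fi t t0)). Qed.

(** A primitive is continuous, hence measurable and bounded on each [0, t], and a bounded measurable
    factor preserves integrability. *)
Lemma locally_integrableM f (f' : R -> R) g :
  primitive_of f f' -> locally_integrable0 g ->
  locally_integrable0 (fun t => f t * g t).
Proof.
move=> ff' gi t t0.
have := integrableMr (mu := mu) _ (primitive_measurable ff' t0)
  (primitive_bounded ff' t0) (gi t t0).
exact.
Qed.

Lemma primitive_itv f (f' : R -> R) s t :
  primitive_of f f' -> 0 <= s -> s <= t ->
  f t - f s = \int[mu]_(x in `[s, t]) f' x.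
Proof.
move=> [fi fE] s0 st; have t0 := le_trans s0 st.
rewrite (fE t)// (fE s)// opprD addrACA subrr add0r Rintegral_itvB//.
  rewrite Rintegral_itv_obnd_cbnd//.
  apply: integrableS (fi t t0) => //; exact: subset_itv.
exact: fi.
Qed.

(** Integration by parts, obtained from the triangle swap applied to the derivatives [f'] and
    [g']. *)
Lemma primitiveM f (f' : R -> R) g (g' : R -> R) :
  primitive_of f f' -> primitive_of g g' ->
  primitive_of (fun t => f t * g t) (fun t => f' t * g t + f t * g' t).
Proof.
move=> ff' gg'.
have [[f'i fE] [g'i gE]] := (ff', gg').
have fg'i := locally_integrableM ff' g'i.
have f'gi : locally_integrable0 (fun t => f' t * g t).
  rewrite (_ : (fun t => _) = (fun t => g t * f' t)).
    exact: locally_integrableM gg' f'i.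
  by apply/funext => t; rewrite mulrC.
split; first exact: locally_integrableD.
move=> T T0.
have := Rintegral_triangle_swap (f'i T T0) (g'i T T0).
(* The inner integrals are g(s) - g(0) on the left and f(T) - f(t) on the right; the remaining
   integrals of [f'] and [g'] alone are endpoint differences. *)
rewrite (@eq_Rintegral _ _ _ mu _ (fun s => f' s * g s - g 0 * f' s));
  last first.
  move=> s /set_mem/=; rewrite in_itv/= => /andP[s0 sT].
  by rewrite (gE s)// mulrDr [g 0 * _]mulrC addrAC subrr add0r.
rewrite [RHS](@eq_Rintegral _ _ _ mu _ (fun t => f T * g' t - f t * g' t));
  last first.
  move=> t /set_mem/=; rewrite in_itv/= => /andP[t0 tT].
  by rewrite -(primitive_itv ff')// mulrBr ![g' t * _]mulrC.
rewrite !RintegralB//; try by [exact: f'gi|exact: fg'i|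
  exact: locally_integrableZ].
rewrite !RintegralZl//; try by [exact: f'i|exact: g'i].
rewrite RintegralD//; try by [exact: f'gi|exact: fg'i].
move/eqP; rewrite subr_eq => /eqP ->.
rewrite -(primitive_itv ff' (lexx 0) T0) -(primitive_itv gg' (lexx 0) T0).
by ring.
Qed.

Lemma primitiveD f (f' : R -> R) g (g' : R -> R) :
  primitive_of f f' -> primitive_of g g' ->
  primitive_of (fun t => f t + g t) (fun t => f' t + g' t).
Proof.
move=> [f'i fE] [g'i gE]; split; first exact: locally_integrableD.
move=> t t0; rewrite RintegralD//; [|exact: f'i|exact: g'i].
by rewrite fE// gE//; ring.
Qed.

Lemma primitiveZ (c : R) f (f' : R -> R) : primitive_of f f' ->
  primitive_of (fun t => c * f t) (fun t => c * f' t).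
Proof.
move=> [f'i fE]; split; first exact: locally_integrableZ.
by move=> t t0; rewrite RintegralZl//; [rewrite fE// mulrDr|exact: f'i].
Qed.

Lemma primitive0 : primitive_of (fun=> 0 : R) (fun=> 0).
Proof.
split=> [t t0|t t0]; first exact: integrable0.
by rewrite Rintegral_cst// mul0r addr0.
Qed.

Lemma primitive_sum (I : finType) (h h' : I -> R -> R) :
  (forall i, primitive_of (h i) (h' i)) ->
  primitive_of (fun t => \sum_i h i t) (fun t => \sum_i h' i t).
Proof.
move=> hh'; elim: (index_enum I) => [|i r IH].
  by have := primitive0; congr primitive_of; apply/funext => t; rewrite big_nil.
have := primitiveD (hh' i) IH.
by congr primitive_of; apply/funext => t; rewrite big_cons.
Qed.

End LocallyAbsolutelyContinuous.

(** * Bounds for bilinear and quadratic forms *)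

Section Forms.
Variable R : realType.

Definition bform m n (A : 'M[R]_(m, n)) (x : 'cV_m) (y : 'cV_n) : R :=
  (x^T *m A *m y) 0 0.

Definition sqnorm n (x : 'cV[R]_n) : R := \sum_i x i 0 ^+ 2.

Section Bilinear.
Variables (m n : nat) (A : 'M[R]_(m, n)).
Implicit Types (x : 'cV[R]_m) (y : 'cV[R]_n) (c : R).

Lemma bformE x y : bform A x y = \sum_i \sum_j A i j * (x i 0 * y j 0).
Proof.
rewrite /bform -mulmxA mxE; apply: eq_bigr => i _.
rewrite !mxE mulr_sumr; apply: eq_bigr => j _.
by rewrite mulrCA mulrA.
Qed.

Lemma bform_tr x y : bform A x y = bform A^T y x.
Proof.
rewrite /bform -[in RHS](trmxK x) -mulmxA -!trmx_mul.
by rewrite [RHS]mxE.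
Qed.

Lemma bformDl x1 x2 y : bform A (x1 + x2) y = bform A x1 y + bform A x2 y.
Proof. by rewrite /bform linearD/= !mulmxDl mxE. Qed.

Lemma bformZl c x y : bform A (c *: x) y = c * bform A x y.
Proof. by rewrite /bform linearZ/= -!scalemxAl mxE. Qed.

Lemma bformDr x y1 y2 : bform A x (y1 + y2) = bform A x y1 + bform A x y2.
Proof. by rewrite /bform mulmxDr mxE. Qed.

Lemma bformZr c x y : bform A x (c *: y) = c * bform A x y.
Proof. by rewrite /bform -!scalemxAr mxE. Qed.

Lemma bform_mul (p : nat) x (B : 'M[R]_(n, p)) z :
  bform A x (B *m z) = bform (A *m B) x z.
Proof. by rewrite /bform !mulmxA. Qed.

End Bilinear.

Lemma bform_congr m n (A : 'M[R]_m) (P : 'M[R]_(m, n)) x y :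
  bform (P^T *m A *m P) x y = bform A (P *m x) (P *m y).
Proof. by rewrite /bform trmx_mul !mulmxA. Qed.

Lemma bform1 n (x : 'cV[R]_n) : bform 1%:M x x = sqnorm x.
Proof.
by rewrite /bform mulmx1 mxE; apply: eq_bigr => i _; rewrite mxE expr2.
Qed.

Lemma sqnorm_ge0 n (x : 'cV[R]_n) : 0 <= sqnorm x.
Proof. by apply: sumr_ge0 => i _; exact: sqr_ge0. Qed.

Lemma le_sqnorm n (x : 'cV[R]_n) i : x i 0 ^+ 2 <= sqnorm x.
Proof.
by rewrite /sqnorm (bigD1 i)//= lerDl sumr_ge0// => j _; exact: sqr_ge0.
Qed.

Lemma sqnormZ n c (x : 'cV[R]_n) : sqnorm (c *: x) = c ^+ 2 * sqnorm x.
Proof. by rewrite mulr_sumr; apply: eq_bigr => i _; rewrite mxE exprMn. Qed.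

Lemma bform_bounded m n (A : 'M[R]_(m, n)) : exists2 C, 0 < C &
  forall x y, `|bform A x y| <= C * (sqnorm x + sqnorm y).
Proof.
(* The summand 1 keeps the constant positive even when A = 0. *)
exists (1 + \sum_i \sum_j `|A i j|).
  by rewrite ltr_pwDl// sumr_ge0// => i _; rewrite sumr_ge0.
move=> x y; rewrite mulrDl mul1r bformE.
apply: (@le_trans _ _ ((\sum_i \sum_j `|A i j|) * (sqnorm x + sqnorm y))).
  rewrite (le_trans (ler_norm_sum _ _ _))// mulr_suml ler_sum// => i _.
  rewrite (le_trans (ler_norm_sum _ _ _))// mulr_suml ler_sum// => j _.
  rewrite normrM ler_wpM2l//.
  apply: le_trans (lerD (le_sqnorm x i) (le_sqnorm y j)).
  rewrite ler_norml; apply/andP; split; nra.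
by rewrite lerDr addr_ge0// sqnorm_ge0.
Qed.

(** Young's inequality with a weight: the form is unchanged when x is scaled by s and y by 1/s, so a
    small s shifts the cost from x to y. *)
Lemma bform_bounded_small m n (A : 'M[R]_(m, n)) (d : R) : 0 < d ->
  exists2 C, 0 < C &
  forall x y, `|bform A x y| <= d * sqnorm x + C * sqnorm y.
Proof.
move=> d0; have [C C0 AC] := bform_bounded A.
(* This choice gives s <= 1 and C s <= d, hence C s^2 <= d, without a square root. *)
pose s := d / (C + d).
have s0 : 0 < s by rewrite divr_gt0// addr_gt0.
have s1 : s <= 1 by rewrite ler_pdivrMr ?addr_gt0// mul1r lerDr ltW.
have Cs : C * s <= d.
  by rewrite mulrA ler_pdivrMr ?addr_gt0//; nra.
exists (C / s ^+ 2); first by rewrite divr_gt0// exprn_gt0.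
move=> x y; have := AC (s *: x) (s^-1 *: y).
rewrite bformZl bformZr mulVKf ?gt_eqF// !sqnormZ => /le_trans; apply.
have Cs2 : C * s ^+ 2 <= d.
  by apply: le_trans Cs; rewrite expr2 mulrA ler_piMr// mulr_ge0 ?ltW.
rewrite mulrDr exprVn (mulrA C (s ^+ 2)) (mulrA C (s ^+ 2)^-1) lerD2r.
by rewrite ler_wpM2r ?sqnorm_ge0.
Qed.

Lemma posdef_ge0 n (P : 'M[R]_n) x : posdef P -> 0 <= bform P x x.
Proof.
move=> [_ Ppos]; have [->|/Ppos/ltW//] := eqVneq x 0.
by rewrite /bform mulmx0 mxE.
Qed.

Lemma posdef_unit n (P : 'M[R]_n) : posdef P -> P \in unitmx.
Proof.
move=> [Psym Ppos]; rewrite unitmxE unitfE; apply/negP => /det0P[v v0 vP].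
have : v^T != 0 by rewrite -trmx0 (inj_eq trmx_inj).
by move/Ppos; rewrite trmxK vP mul0mx mxE ltxx.
Qed.

(** Full column rank makes x -> A x injective, so a nonzero x yields a nonzero argument of the form
    P. *)
Lemma posdef_congr m n (P : 'M[R]_m) (A : 'M[R]_(m, n)) :
  posdef P -> \rank A = n -> posdef (A^T *m P *m A).
Proof.
move=> [Psym Ppos] rA; split; first by rewrite !trmx_mul trmxK Psym mulmxA.
move=> x x0; have := Ppos (A *m x); rewrite trmx_mul !mulmxA; apply.
rewrite -(inj_eq trmx_inj) trmx_mul trmx0 mulmx_free_eq0.
  by rewrite -trmx0 (inj_eq trmx_inj).
by rewrite /row_free mxrank_tr rA.
Qed.

(* Expand [0 <= (x - s P^-1 x)^T P (x - s P^-1 x)] with [1 / s] a bound on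
   [P^-1]. *)
Lemma posdef_coercive n (P : 'M[R]_n) : posdef P -> exists2 c, 0 < c &
  forall x, c * sqnorm x <= bform P x x.
Proof.
move=> Ppos; have Pu := posdef_unit Ppos; have [Psym _] := Ppos.
have [C C0 PC] := bform_bounded (invmx P).
pose s := (2 * C)^-1.
have s0 : 0 < s by rewrite invr_gt0 mulr_gt0.
exists s => // x.
have := posdef_ge0 (x - s *: (invmx P *m x)) Ppos.
have := PC x x; rewrite ler_norml => /andP[_].
rewrite -scaleNr !bformDl !bformDr !bformZl !bformZr.
rewrite -[_ (invmx P *m x) (invmx P *m x)]bform_congr trmx_inv Psym.
rewrite mulVmx// mul1mx bform_mul mulmxV// bform1.
rewrite [_ (invmx P *m x) x]bform_tr Psym bform_mul mulmxV// bform1.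
move=> PCx.
have : s * bform (invmx P) x x <= sqnorm x.
  by rewrite /s ler_pdivrMl ?mulr_gt0// (le_trans PCx)//; lra.
move/(ler_wpM2l (ltW s0)); nra.
Qed.

End Forms.

(** * A strict Lyapunov function *)

Section Lyapunov.
Variables (R : realType) (n : nat) (M D K : 'M[R]_n).

(** Twice the energy plus a cross term. The energy alone decays only through v^T D v, which does not
    see x; the derivative of the cross term contributes - 2 e x^T K x. *)
Definition lyap (e : R) (x v : 'cV[R]_n) : R :=
  bform M v v + bform K x x + 2 * e * bform M x v.

(* derivative of [lyap] along the solutions of M x'' + D x' + K x = 0 *)
Definition dlyap (e : R) (x v : 'cV[R]_n) : R :=
  - 2 * bform D v v + 2 * e * (bform M v v - bform D x v - bform K x x).

Lemma lyapunov_strict : posdef M -> posdef D -> posdef K ->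
  exists e b c : R, [/\ 0 < b, 0 < c,
    forall x v, b * (sqnorm x + sqnorm v) <= lyap e x v &
    forall x v, dlyap e x v <= - c * lyap e x v].
Proof.
move=> Mpos Dpos Kpos.
have [m m0 mM] := posdef_coercive Mpos.
have [d d0 dD] := posdef_coercive Dpos.
have [k k0 kK] := posdef_coercive Kpos.
have [a a0 aM] := bform_bounded M.
have [a' a'0 aK] := bform_bounded K.
(* With weight k/2 the mixed term x^T D v uses up only half of the decay supplied by x^T K x. *)
have k20 : 0 < k / 2 by rewrite divr_gt0.
have [C C0 CD] := bform_bounded_small D k20.
(* The first bound lets the damping absorb all terms of order e in v, at the cost of half of it; the
   other two keep the cross term below half of m |v|^2 + k |x|^2. *)
pose e := Num.min (d / (2 * (2 * a + C))) (Num.min (m / (4 * a)) (k / (4 * a))).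
have e0 : 0 < e by rewrite !lt_min !divr_gt0// ?mulr_gt0// addr_gt0// mulr_gt0.
have e1 : e * (2 * (2 * a + C)) <= d.
  by rewrite -ler_pdivlMr ?mulr_gt0 ?addr_gt0 ?mulr_gt0// /e ge_min lexx.
have e2 : e * (4 * a) <= m.
  by rewrite -ler_pdivlMr ?mulr_gt0// /e !ge_min lexx ?orbT.
have e3 : e * (4 * a) <= k.
  by rewrite -ler_pdivlMr ?mulr_gt0// /e !ge_min lexx ?orbT.
have {aM} aM x v : e * `|bform M x v| <= e * a * (sqnorm x + sqnorm v).
  by rewrite -mulrA ler_wpM2l// ltW.
pose b := Num.min m k / 2.
have b0 : 0 < b by rewrite divr_gt0// lt_min m0.
have bm : 2 * b <= m by rewrite /b mulrC divfK// ge_min lexx.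
have bk : 2 * b <= k by rewrite /b mulrC divfK// ge_min lexx orbT.
(* With N = |x|^2 + |v|^2, [lyap] is at most B N and [dlyap] at most - g N, whence the decay rate g
   / B. *)
pose B := 2 * a + 2 * a' + 2 * (e * a).
have B0 : 0 < B by rewrite !addr_gt0// !mulr_gt0.
pose g := Num.min d (e * k).
have g0 : 0 < g by rewrite lt_min d0 mulr_gt0.
have gd : g <= d by rewrite /g ge_min lexx.
have gk : g <= e * k by rewrite /g ge_min lexx orbT.
exists e, b, (g / B); split => //; first exact: divr_gt0.
  move=> x v; rewrite /lyap.
  have := aM x v; have := mM v; have := kK x.
  have := sqnorm_ge0 x; have := sqnorm_ge0 v.
  move: (sqnorm x) (sqnorm v) => X V V0 X0 kX mV MX.
  have : - (e * bform M x v) <= e * `|bform M x v|.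
    by rewrite -mulrN ler_wpM2l ?(ltW e0)// -normrN ler_norm.
  have := ler_wpM2r X0 e3; have := ler_wpM2r V0 e2.
  have := ler_wpM2r X0 bk; have := ler_wpM2r V0 bm.
  rewrite /=; nra.
move=> x v; have X0 := sqnorm_ge0 x; have V0 := sqnorm_ge0 v.
apply: (@le_trans _ _ (- g * (sqnorm x + sqnorm v))).
  rewrite /dlyap.
  have Mv : e * bform M v v <= e * (2 * a) * sqnorm v.
    apply: (@le_trans _ _ (e * `|bform M v v|)).
      by rewrite ler_wpM2l ?(ltW e0)// ler_norm.
    by apply: le_trans (aM v v) _; lra.
  have Dxv : - (e * bform D x v) <= e * (k / 2 * sqnorm x + C * sqnorm v).
    rewrite -mulrN ler_wpM2l ?(ltW e0)//.
    by apply: le_trans (CD x v); rewrite -normrN ler_norm.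
  have Kx := ler_wpM2l (ltW e0) (kK x).
  have Dv := dD v.
  have h1 := ler_wpM2r V0 e1; have h2 := ler_wpM2r V0 gd.
  have h3 := ler_wpM2r X0 gk.
  move: (sqnorm x) (sqnorm v) X0 V0 Mv Dxv Kx Dv h1 h2 h3.
  by move=> X V X0 V0 Mv Dxv Kx Dv h1 h2 h3; lra.
rewrite !mulNr lerN2 -mulrA ler_wpM2l ?(ltW g0)// ler_pdivrMl//.
rewrite /lyap /B.
have h1 : bform M v v <= a * (sqnorm v + sqnorm v).
  have /(le_trans (ler_wpM2l (ltW e0) (ler_norm _))) := aM v v.
  by rewrite -mulrA ler_pM2l.
have h2 : bform K x x <= a' * (sqnorm x + sqnorm x).
  exact: le_trans (ler_norm _) (aK _ _).
have /(le_trans (ler_wpM2l (ltW e0) (ler_norm _))) h3 := aM x v.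
have h4 := mulr_ge0 (ltW a0) X0; have h5 := mulr_ge0 (ltW a'0) V0.
by lra.
Qed.

End Lyapunov.

(** * Linear differential equations solved by power series *)

Section LinearODE.
Variable R : realType.
Notation mu := (@lebesgue_measure R).

Lemma is_derive_primitive (f f' : R -> R) :
  (forall t, is_derive t (1 : R) f (f' t)) -> continuous f' ->
  primitive_of f f'.
Proof.
move=> df cf.
have f'i : locally_integrable0 f'.
  move=> t t0; apply: continuous_compact_integrable.
    exact: segment_compact.
  exact: continuous_subspaceT.
have cF : continuous f.
  move=> t; apply: differentiable_continuous; apply/derivable1_diffP.
  by have [] := df t.
(* The degenerate interval t = 0 is treated apart, since the fundamental theorem is applied on
   [0, t] with 0 < t. *)
split=> // t; rewrite le_eqVlt => /predU1P[<-|t0].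
  by rewrite set_itv1 Rintegral_set1 addr0.
rewrite /Rintegral (continuous_FTC2 (F := f) t0).
- by rewrite -EFinB/=; ring.
- exact: continuous_subspaceT.
- split.
  + by move=> x _; have [] := df x.
  + exact: cvg_at_right_filter (cF 0).
  + exact: cvg_at_left_filter (cF t).
- by move=> x _; rewrite derive1E; have [] := df x.
Qed.

Variables (N : nat) (A : 'M[R]_N).
Implicit Types (z : 'cV[R]_N) (i : 'I_N).

(* Taylor coefficients at 0 of the i-th entry of the solution of [z' = A z] *)
Let c z i (k : nat) : R := iter k (mulmx A) z i 0 / k`!%:R.

(** Entry i of exp(t A) z. Working entry by entry keeps every series a scalar power series. *)
Let y z i (t : R) : R := limn (pseries (c z i) t).

Let norm1 z : R := \sum_i `|z i 0|.
(** An upper bound for the operator norm of A with respect to [norm1]. *)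
Let a : R := \sum_i \sum_j `|A i j|.

Let norm1_iter z k : norm1 (iter k (mulmx A) z) <= norm1 z * a ^+ k.
Proof.
have a0 : 0 <= a by apply: sumr_ge0 => i _; exact: sumr_ge0.
elim: k => [|k IH]; first by rewrite expr0 mulr1.
rewrite iterS exprS mulrCA; apply: le_trans (ler_wpM2l a0 IH).
rewrite mulr_suml; apply: ler_sum => i _.
rewrite mxE (le_trans (ler_norm_sum _ _ _))// mulr_suml; apply: ler_sum => j _.
rewrite normrM ler_wpM2l// /norm1 (bigD1 j)//= lerDl.
exact: sumr_ge0.
Qed.

(** Absolute convergence by comparison with [norm1 z] times the exponential series at a |t|. *)
Let cvg_pseries z i t : cvgn (pseries (c z i) t).
Proof.
have a0 : 0 <= a by apply: sumr_ge0 => j _; exact: sumr_ge0.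
have n0 : 0 <= norm1 z by exact: sumr_ge0.
apply: normed_cvg.
apply: (@series_le_cvg _ _ (fun k => norm1 z * exp_coeff (a * `|t|) k)) => /=.
- by [].
- move=> k; rewrite mulr_ge0// /exp_coeff/= divr_ge0// exprn_ge0//.
  by rewrite mulr_ge0.
- move=> k; rewrite /c /exp_coeff/= !normrM normfV normr_nat normrX exprMn.
  rewrite mulrAC !mulrA ler_wpM2r// ?invr_ge0// ler_wpM2r ?exprn_ge0//.
  apply: le_trans (norm1_iter z k).
  by rewrite /norm1 (bigD1 i)//= lerDl sumr_ge0.
- exact: is_cvg_seriesZ (is_cvg_series_exp_coeff _).
Qed.

(** Termwise differentiation amounts to replacing z by A z, so derived series are again of the same
    kind. *)
Let c_diffs z i : pseries_diffs (c z i) = c (A *m z) i.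
Proof.
apply/funext => k; rewrite /pseries_diffs /c -iterSr factS natrM invfM.
by rewrite mulrCA mulVKf ?pnatr_eq0.
Qed.

Let is_derive_y z i t : is_derive t (1 : R) (y z i) (y (A *m z) i t).
Proof.
(* Any point strictly beyond |t| would serve; the series and its first two derived series converge
   there. *)
rewrite /y -c_diffs; apply: (@pseries_snd_diffs _ _ (`|t| + 1)).
- exact: cvg_pseries.
- by rewrite c_diffs; exact: cvg_pseries.
- by rewrite !c_diffs; exact: cvg_pseries.
- by rewrite [ltRHS]ger0_norm ?addr_ge0// ltrDl.
Qed.

Let y_mul z i t : y (A *m z) i t = \sum_j A i j * y z j t.
Proof.
apply/cvg_lim => //.
rewrite (_ : pseries _ t = fun n => \sum_j A i j * pseries (c z j) t n).
  apply: cvg_big => [|j _]; first exact: add_continuous.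
  by apply: cvgMl_tmp; exact: cvg_pseries.
apply/funext => n; rewrite /pseries /series/=.
under [RHS]eq_bigr do rewrite mulr_sumr.
rewrite exchange_big; apply: eq_bigr => k _.
rewrite /c -iterSr iterS mxE mulr_suml mulr_suml; apply: eq_bigr => j _.
by rewrite !mulrA.
Qed.

Let y0 z i : y z i 0 = z i 0.
Proof.
(* The partial sum of index 0 is empty; after the shift all partial sums at t = 0 equal the constant
   term. *)
apply/cvg_lim => //; rewrite -cvg_shiftS.
rewrite (_ : (fun n => _) = fun=> z i 0); first exact: cvg_cst.
apply/funext => n; rewrite /pseries /series/= big_nat_recl//= big1.
  by rewrite expr0 mulr1 addr0 /c/= fact0 divr1.
by move=> k _; rewrite expr0n/= mulr0.
Qed.

Lemma linear_ode_solution z : exists Z : R -> 'cV[R]_N,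
  [/\ Z 0 = z &
    forall i, primitive_of (fun t => Z t i 0) (fun t => (A *m Z t) i 0)].
Proof.
exists (fun t => \col_i y z i t); split.
  by apply/colP => i; rewrite mxE y0.
move=> i.
have -> : (fun t => (\col_i y z i t) i 0) = y z i.
  by apply/funext => t; rewrite mxE.
have -> : (fun t => (A *m \col_i y z i t) i 0) = y (A *m z) i.
  apply/funext => t; rewrite y_mul mxE; apply: eq_bigr => j _.
  by rewrite mxE.
apply: is_derive_primitive; first exact: is_derive_y.
move=> t; apply: differentiable_continuous; apply/derivable1_diffP.
by have [] := is_derive_y (A *m z) i t.
Qed.

End LinearODE.

(** * Passivity and stability for positive definite coefficients *)

Section PositiveSystems.
Variables (R : realType) (n : nat).
Notation mu := (@lebesgue_measure R).
Implicit Types (sys : sosys R n).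

Lemma primitive_bform m (A : 'M[R]_(m, n)) (x x' : R -> 'cV[R]_m)
    (y y' : R -> 'cV[R]_n) :
  (forall i, primitive_of (fun t => x t i 0) (fun t => x' t i 0)) ->
  (forall j, primitive_of (fun t => y t j 0) (fun t => y' t j 0)) ->
  primitive_of (fun t => bform A (x t) (y t))
    (fun t => bform A (x' t) (y t) + bform A (x t) (y' t)).
Proof.
move=> xx' yy'.
have := primitive_sum (fun i => primitive_sum (fun j =>
  primitiveZ (A i j) (primitiveM (xx' i) (yy' j)))).
congr primitive_of; apply/funext => t; rewrite !bformE//.
rewrite -big_split; apply: eq_bigr => i _.
rewrite -big_split; apply: eq_bigr => j _.
by rewrite /= mulrDr.
Qed.

(** The equation of motion holds only almost everywhere; this lets it be substituted into the
    derivative of an energy. *)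
Lemma primitive_of_ae (f f' g : R -> R) :
  primitive_of f f' -> locally_integrable0 g ->
  {ae mu, forall t : R, 0 <= t -> f' t = g t} -> primitive_of f g.
Proof.
move=> [f'i fE] gi f'g; split => // t t0; rewrite fE//; congr (_ + fine _).
apply: ae_eq_integral => //.
- exact: measurable_int (f'i t t0).
- exact: measurable_int (gi t t0).
- apply: (@filterS _ _ (ae_filter_ringOfSetsType mu) _ _ _ f'g) => s /= f'gs.
  rewrite in_itv/= => /andP[s0 _].
  by rewrite f'gs.
Qed.

Lemma passive_posdef sys : posdef (F2 sys) -> posdef (F1 sys) ->
  posdef (F0 sys) -> H1 sys = (G sys)^T -> H0 sys = 0 -> passive sys.
Proof.
move=> Mpos Dpos Kpos H1E H0E.
exists (fun x v => 2^-1 * (bform (F2 sys) v v + bform (F0 sys) x x)); split.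
  by move=> x v; rewrite mulr_ge0// addr_ge0// posdef_ge0.
move=> u x v [ui [a [xv va eqn]]] s t s0 st.
(* Seen as a bilinear form in the constant G and in v, the output is locally absolutely continuous,
   so its product with the input is locally integrable. *)
have outE r : output sys x v r = bform (1%:M : 'M[R]_n) (G sys) (v r).
  by rewrite /output H1E H0E mul0mx addr0 /bform mulmx1.
have c0 (w : 'cV[R]_n) i :
    primitive_of (fun=> w i 0) (fun=> (0 : 'cV[R]_n) i 0).
  have [_ E] := primitive0 R; split.
    by rewrite mxE; have [] := primitive0 R.
  by move=> r r0; rewrite mxE -[LHS]addr0 {1}(E r r0) add0r.
have out_prim := primitive_bform 1%:M (c0 (G sys)) va.
have uoi : locally_integrable0 (fun r => u r * output sys x v r).
  rewrite (_ : (fun r => _) =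
    fun r => bform (1%:M : 'M[R]_n) (G sys) (v r) * u r).
    exact: locally_integrableM out_prim ui.
  by apply/funext => r; rewrite outE mulrC.
have Dvi := primitive_locally_integrable (primitive_bform (F1 sys) va va).
have dVi : locally_integrable0
    (fun r => u r * output sys x v r + (-1) * bform (F1 sys) (v r) (v r)).
  by apply: locally_integrableD => //; exact: locally_integrableZ.
have dV := primitiveZ 2^-1 (primitiveD (primitive_bform (F2 sys) va va)
  (primitive_bform (F0 sys) xv xv)).
have {}dV : primitive_of
    (fun r => 2^-1 * (bform (F2 sys) (v r) (v r) + bform (F0 sys) (x r) (x r)))
    (fun r => u r * output sys x v r + (-1) * bform (F1 sys) (v r) (v r)).
  apply: primitive_of_ae dV dVi _.
  apply: (@filterS _ _ (ae_filter_ringOfSetsType mu) _ _ _ eqn).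
  move=> r eqr /eqr{eqr} eqr.
  (* Symmetry merges the two terms of each product rule; pairing the equation of motion with v then
     gives the power balance. *)
  rewrite [bform _ (a r) _]bform_tr Mpos.1 [bform _ (v r) (x r)]bform_tr Kpos.1.
  rewrite outE [bform _ (G sys) _]bform_tr trmx1.
  have := congr1 (bform 1%:M (v r)) eqr.
  rewrite !bformDr bformZr !bform_mul !mul1mx.
  rewrite [bform _ (v r) (x r)]bform_tr Kpos.1.
  by lra.
rewrite (primitive_itv dV s0 st).
have t0 := le_trans s0 st.
have sub : `[s, t] `<=` `[0, t] by apply: subset_itvr; rewrite bnd_simp.
(* The dissipated power v^T F1 v is nonnegative and is dropped. *)
apply: le_Rintegral => //.
- by apply: integrableS (dVi t t0).
- by apply: integrableS (uoi t t0).
- by move=> r _; rewrite gerDl mulN1r oppr_le0 posdef_ge0.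
Qed.

(** The rate 1/t suffices for convergence to zero and needs only monotonicity of the integral, not
    Gronwall's inequality. *)
Lemma lyapunov_decay (e e' : R -> R) (c : R) : 0 < c -> primitive_of e e' ->
  (forall t, 0 <= t -> 0 <= e t) -> (forall t, 0 <= t -> e' t <= - c * e t) ->
  forall t, 0 < t -> e t <= e 0 / (c * t).
Proof.
move=> c0 ee' e_ge0 e'_le t t0; have [e'i eE] := ee'.
have mono s : 0 <= s -> s <= t -> e t <= e s.
  move=> s0 st; rewrite -subr_le0 (primitive_itv ee' s0 st).
  have -> : 0 = \int[mu]_(r in `[s, t]) (cst 0 r : R).
    by rewrite Rintegral_cst// mul0r.
  apply: le_Rintegral => //.
  - apply: integrableS (e'i t (ltW t0)) => //.
    by apply: subset_itvr; rewrite bnd_simp.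
  - exact: integrable0.
  - move=> r /=; rewrite in_itv/= => /andP[sr _].
    have r0 := le_trans s0 sr; rewrite (le_trans (e'_le r r0))//.
    by rewrite mulNr oppr_le0 mulr_ge0 ?(ltW c0) ?e_ge0.
rewrite ler_pdivlMr ?mulr_gt0//.
(* On [0, t] monotonicity gives e'(r) <= - c e(r) <= - c e(t), a constant. *)
have : \int[mu]_(r in `[0, t]) e' r <=
    \int[mu]_(r in `[0, t]) (cst (- c * e t) r).
  apply: le_Rintegral => //; first exact: e'i (ltW t0).
    apply: continuous_compact_integrable; first exact: segment_compact.
    by apply: continuous_subspaceT => ?; exact: cvg_cst.
  move=> r /=; rewrite in_itv/= => /andP[r0 rt].
  by rewrite (le_trans (e'_le r r0))// !mulNr lerN2 ler_pM2l// mono.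
rewrite Rintegral_cst//= lebesgue_measure_itv/= lte_fin t0 -EFinB/= subr0.
have := eE t (ltW t0); have := e_ge0 t (ltW t0).
by move=> et0 eT h; lra.
Qed.

Lemma cvg_cV_sqnorm (x : R -> 'cV[R]_n) (b : R) :
  (forall t, 0 < t -> sqnorm (x t) <= b / t) ->
  x t @[t --> +oo] --> (0 : 'cV[R]_n).
Proof.
move=> xb P [Q Q0 QP].
have xi0 i : x t i 0 @[t --> +oo] --> (0 : R).
  apply/cvgrPdist_le => eps eps0.
  have b_real : b / eps ^+ 2 \is Num.real by exact: num_real.
  apply: filterS2 (nbhs_pinfty_gt (num_real 0)) (nbhs_pinfty_ge b_real).
  move=> t t0 bt.
  rewrite sub0r normrN -(ler_pXn2r (n := 2))// ?nnegrE ?(ltW eps0)//.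
  rewrite real_normK ?num_real// (le_trans (le_sqnorm _ i))//.
  rewrite (le_trans (xb t t0))// ler_pdivrMr// mulrC.
  rewrite -ler_pdivrMr ?exprn_gt0//; exact: bt.
(* Neighbourhoods of a vector are entrywise, and finitely many entries can be handled together. *)
suff : \forall t \near +oo, forall i, Q i 0 (x t i 0).
  by apply: filterS => t Qx; apply: QP => i j; rewrite ord1.
apply: filter_forall => i; apply: xi0.
by have := Q0 i 0; rewrite mxE.
Qed.

Lemma asymptotically_stable_posdef sys : posdef (F2 sys) ->
  posdef (F1 sys) -> posdef (F0 sys) -> asymptotically_stable sys.
Proof.
move=> Mpos Dpos Kpos x0 v0; split.
  have Mu := posdef_unit Mpos.
  (* The companion matrix of the first-order system for the stacked vector (x, v), available because
     F2 is invertible. *)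
  pose A := block_mx 0 1%:M (- (invmx (F2 sys) *m F0 sys))
                            (- (invmx (F2 sys) *m F1 sys)).
  have [Z [Z0 Zprim]] := linear_ode_solution A (col_mx x0 v0).
  exists (usubmx \o Z), (dsubmx \o Z); split.
  - split; first by move=> t t0; exact: integrable0.
    exists (fun t => dsubmx (A *m Z t)).
    have AZ t : A *m Z t = col_mx (dsubmx (Z t))
       (- (invmx (F2 sys) *m F0 sys *m usubmx (Z t))
        - (invmx (F2 sys) *m F1 sys *m dsubmx (Z t))).
      rewrite -[in LHS](vsubmxK (Z t)) mul_block_col mul0mx mul1mx add0r.
      by rewrite !mulNmx.
    split.
    + move=> i; have := Zprim (lshift n i); congr primitive_of.
        by apply/funext => t; rewrite /= mxE.
      by apply/funext => t; rewrite AZ col_mxEu.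
    + move=> i; have := Zprim (rshift n i); congr primitive_of.
        by apply/funext => t; rewrite /= mxE.
      by apply/funext => t; rewrite [RHS]mxE.
    + apply: aeW => t t0; rewrite scale0r AZ col_mxKd /=.
      rewrite mulmxDr !mulmxN -!mulmxA !mulKVmx//.
      by rewrite subrK addNr.
  - by rewrite /= Z0 col_mxKu.
  - by rewrite /= Z0 col_mxKd.
move=> x v [_ [a [xv va eqn]]] _ _.
have [e [b [c [b0 c0 lyap_ge dlyap_le]]]] := lyapunov_strict Mpos Dpos Kpos.
have dE := primitiveD (primitiveD (primitive_bform (F2 sys) va va)
  (primitive_bform (F0 sys) xv xv))
  (primitiveZ (2 * e) (primitive_bform (F2 sys) xv va)).
have dEi : locally_integrable0
    (fun t => dlyap (F2 sys) (F1 sys) (F0 sys) e (x t) (v t)).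
  have [/primitive_locally_integrable Mi /primitive_locally_integrable Ki
    /primitive_locally_integrable Di /primitive_locally_integrable Ci] := And4
    (primitive_bform (F2 sys) va va) (primitive_bform (F0 sys) xv xv)
    (primitive_bform (F1 sys) va va) (primitive_bform (F1 sys) xv va).
  have := locally_integrableD (locally_integrableZ (- 2) Di)
    (locally_integrableZ (2 * e) (locally_integrableD (locally_integrableD Mi
     (locally_integrableZ (-1) Ci)) (locally_integrableZ (-1) Ki))).
  congr locally_integrable0; apply/funext => t.
  by rewrite /dlyap !mulN1r.
have {}dE : primitive_of (fun t => lyap (F2 sys) (F0 sys) e (x t) (v t))
    (fun t => dlyap (F2 sys) (F1 sys) (F0 sys) e (x t) (v t)).
  apply: primitive_of_ae dE dEi _.
  apply: (@filterS _ _ (ae_filter_ringOfSetsType mu) _ _ _ eqn).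
  move=> t eqt /eqt{eqt} eqt.
  rewrite [bform _ (a t) _]bform_tr Mpos.1 [bform _ (v t) (x t)]bform_tr Kpos.1.
  (* Pairing the equation with x and with v eliminates the acceleration from both products that
     contain it. *)
  have := congr1 (bform 1%:M (v t)) eqt; have := congr1 (bform 1%:M (x t)) eqt.
  rewrite !bformDr !bformZr !bform_mul !mul1mx !mul0r.
  rewrite [bform _ (v t) (x t)]bform_tr Kpos.1 /dlyap => eqx eqv.
  have -> : bform (F2 sys) (x t) (a t) =
    - bform (F1 sys) (x t) (v t) - bform (F0 sys) (x t) (x t) by lra.
  have -> : bform (F2 sys) (v t) (a t) =
    - bform (F1 sys) (v t) (v t) - bform (F0 sys) (x t) (v t) by lra.
  by ring.
have bnd t : 0 < t -> sqnorm (x t) + sqnorm (v t) <=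
    lyap (F2 sys) (F0 sys) e (x 0) (v 0) / (c * b) / t.
  move=> t0.
  have := lyapunov_decay c0 dE _ (fun t _ => dlyap_le (x t) (v t)) t0.
  have ge0 s : 0 <= s -> 0 <= lyap (F2 sys) (F0 sys) e (x s) (v s).
    move=> _; apply: le_trans (lyap_ge _ _).
    by rewrite mulr_ge0 ?(ltW b0)// addr_ge0// sqnorm_ge0.
  move=> /(_ ge0) /(le_trans (lyap_ge _ _)).
  rewrite -ler_pdivlMl// => /le_trans; apply.
  by rewrite !invfM; lra.
split; apply: cvg_cV_sqnorm => t /bnd; apply: le_trans.
  by rewrite lerDl sqnorm_ge0.
by rewrite lerDr sqnorm_ge0.
Qed.

End PositiveSystems.

(** * The two reduced systems *)

Theorem proposition6 (R : realType) (n nu : nat)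
    (M D K : 'M[R]_n) (B : 'cV[R]_n) (C1 C0 : 'rV[R]_n)
    (S Q : 'M[R]_nu) (L : 'rV[R]_nu) (r : 'cV[R]_nu)
    (Pi : 'M[R]_(n, nu)) (Ups : 'M[R]_(nu, n)) :
  let Sigma := SoSys M D K B C1 C0 in
  (nu < n)%N ->
  observable L S -> controllable Q r ->
  spectrum S `&` Omega Sigma = set0 ->
  spectrum Q `&` Omega Sigma = set0 ->
  unique (right_sylvester Sigma L S) Pi ->
  unique (left_sylvester Sigma Q r) Ups ->
  \rank Pi = nu -> \rank Ups = nu ->
  asymptotically_stable Sigma ->
  posdef M -> posdef D -> posdef K -> C1 = B^T -> C0 = 0 ->
  let Sigma_G := SoSys (Pi^T *m M *m Pi) (Pi^T *m D *m Pi) (Pi^T *m K *m Pi)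
                   (Pi^T *m B) (B^T *m Pi)
                   (C0 *m Pi + C1 *m Pi *m S - B^T *m Pi *m S) in
  let Sigma_H := SoSys (Ups *m M *m Ups^T) (Ups *m D *m Ups^T)
                   (Ups *m K *m Ups^T) (Ups *m B) (B^T *m Ups^T) 0 in
  [/\ family_G Sigma L S Pi Sigma_G,
      asymptotically_stable Sigma_G & passive Sigma_G] /\
  [/\ family_H Sigma Q r Ups Sigma_H,
      asymptotically_stable Sigma_H & passive Sigma_H].
Proof.
move=> Sigma _ _ _ _ _ [PiE _] [UpsE _] rPi rUps _ Mpos Dpos Kpos C1E C0E.
rewrite /right_sylvester/= in PiE; rewrite /left_sylvester/= in UpsE.
move=> Sigma_G Sigma_H.
have posG A : posdef A -> posdef (Pi^T *m A *m Pi).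
  by move=> Apos; exact: posdef_congr.
have posH A : posdef A -> posdef (Ups *m A *m Ups^T).
  move=> Apos; rewrite -{1}(trmxK Ups); apply: posdef_congr => //.
  by rewrite mxrank_tr.
split; split.
- split=> /=; last by rewrite C1E.
  (* With Pi^T factored out on the left, what remains is the right Sylvester equation solved for K
     Pi. *)
  rewrite -!mulmxA -!mulmxBr; congr (_ *m _).
  by rewrite -PiE -!mulmxA -[RHS]addrA -opprD [X in X - _]addrC addrK.
- by apply: asymptotically_stable_posdef; [exact: posG..].
- apply: passive_posdef => /=; [exact: posG..| |].
    by rewrite trmx_mul trmxK.
  by rewrite C0E C1E mul0mx add0r subrr.
- split=> //=.
  (* The right-hand side of the left Sylvester equation becomes Q r B^T; multiplying the equation by
     Ups^T on the right gives the relation for F0. *)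
  rewrite C0E C1E mulmx0 add0r in UpsE.
  rewrite mulmx0 add0r !mulmxA -!mulmxBl -UpsE; congr (_ *m _).
  by rewrite -[RHS]addrA -opprD [X in X - _]addrC addrK.
- by apply: asymptotically_stable_posdef; [exact: posH..].
- apply: passive_posdef => //=; [exact: posH..|].
  by rewrite trmx_mul.
Qed.
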